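(* Let $\mathfrak{A}$ be a unital $C^*$-algebra with unit $\boldsymbol{1}$ and let $a\in\mathfrak{A}$. Then the following statements hold: (i) If $(\mu,r)\in DW_{\mathfrak{A}}(a)$, then $r\geq|\mu|^2$. (ii) $DW_{\mathfrak{A}}(a)=DW_{\mathfrak{A}}(u^*au)$ for any unitary $u\in\mathfrak{A}$. (iii) $DW_{\mathfrak{A}}(\alpha a+\beta\boldsymbol{1})=\{(\alpha\mu+\beta,\ |\alpha|^2r+2\Re(\alpha\overline{\beta}\mu)+|\beta|^2):(\mu,r)\in DW_{\mathfrak{A}}(a)\}$ for any scalars $\alpha,\beta\in\mathbb{C}$. (iv) If $\mathfrak{A}=\bigoplus_{i=1}^n\mathfrak{A}_i$ is a finite direct sum of unital $C^*$-algebras $\mathfrak{A}_i$ and $a=a_1\oplus\cdots\oplus a_n$ with $a_i\in\mathfrak{A}_i$ for each $i$, then $DW_{\mathfrak{A}}(a)$ is the convex hull (in $\mathbb{C}\times\mathbb{R}$) of $DW_{\mathfrak{A}_1}(a_1)\cup\cdots\cup DW_{\mathfrak{A}_n}(a_n)$.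
   Context: All $C^*$-algebras are complex, nonzero and unital. For such an algebra $\mathfrak{A}$ with unit $\boldsymbol{1}$, the state space $\mathfrak{S}(\mathfrak{A})$ is the set of all positive linear functionals $f\in\mathfrak{A}^*$ with $\|f\|=f(\boldsymbol{1})=1$. The algebraic Davis--Wielandt shell of $a\in\mathfrak{A}$ is $DW_{\mathfrak{A}}(a)=\{(f(a),f(a^*a)):f\in\mathfrak{S}(\mathfrak{A})\}\subset\mathbb{C}\times\mathbb{R}$. *)

(* Defs.v *)
From HB Require Import structures.
From mathcomp Require Import all_boot all_order all_algebra.
From mathcomp Require Import all_classical all_reals all_analysis.
From mathcomp Require Import complex.
Set Implicit Arguments.
Unset Strict Implicit.
Unset Printing Implicit Defensive.
Import Order.TTheory GRing.Theory Num.Theory.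
Import numFieldNormedType.Exports.
Local Open Scope classical_set_scope.
Local Open Scope ring_scope.

(* In a normed module over R[i] the norm `|x| is an element of R[i], which is
   real and nonnegative; rnorm is the same norm with values in R. On scalars,
   rnorm z is the modulus of z. *)
Definition rnorm (R : realType) (V : normedZmodType R[i]) (x : V) : R :=
  complex.Re `|x|.

(* MathComp's ring and normed module structures cannot be joined in one
   HB structure (their only declared common extension is numDomainType), so
   the multiplication is part of the mixin. Every cstarAlgType is made an
   algType right after, and only the operations of algType are used then.
   cone_neq0 says that the algebra is nonzero. *)
HB.mixin Record isCStarAlgebra (R : realType) A
    & CompleteNormedModule R[i] A := {
  cone : A ;
  cmul : A -> A -> A ;
  star : A -> A ;
  cmulA : associative cmul ;
  cmul1l : left_id cone cmul ;
  cmul1r : right_id cone cmul ;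
  cmulDl : left_distributive cmul +%R ;
  cmulDr : right_distributive cmul +%R ;
  cone_neq0 : cone != 0 ;
  cscaleAl : forall (c : R[i]) x y, c *: cmul x y = cmul (c *: x) y ;
  cscaleAr : forall (c : R[i]) x y, c *: cmul x y = cmul x (c *: y) ;
  cnormM_le : forall x y, `|cmul x y| <= `|x| * `|y| ;
  starK : involutive star ;
  starD : {morph star : x y / x + y} ;
  starZ : forall (c : R[i]) x, star (c *: x) = c^* *: star x ;
  cstarM : forall x y, star (cmul x y) = cmul (star y) (star x) ;
  cnorm_starM : forall x, `|cmul (star x) x| = `|x| ^+ 2
}.

#[short(type="cstarAlgType")]
HB.structure Definition CStarAlgebra (R : realType) :=
  {A of CompleteNormedModule R[i] A & isCStarAlgebra R A}.

Section CStarAlgebraIsAlgebra.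
Context {R : realType} (A : cstarAlgType R).

#[export, non_forgetful_inheritance]
HB.instance Definition _ := GRing.Zmodule_isNzRing.Build A
  (@cmulA R A) (@cmul1l R A) (@cmul1r R A) (@cmulDl R A) (@cmulDr R A)
  (@cone_neq0 R A).
#[export, non_forgetful_inheritance]
HB.instance Definition _ :=
  GRing.Lmodule_isLalgebra.Build R[i] A (@cscaleAl R A).
#[export, non_forgetful_inheritance]
HB.instance Definition _ :=
  GRing.Lalgebra_isAlgebra.Build R[i] A (@cscaleAr R A).

Implicit Types x y : A.

Lemma cmulE x y : cmul x y = x * y. Proof. by []. Qed.
Lemma coneE : @cone R A = 1. Proof. by []. Qed.
Lemma normM_le x y : `|x * y| <= `|x| * `|y|. Proof. exact: cnormM_le. Qed.
Lemma starM x y : star (x * y) = star y * star x. Proof. exact: cstarM. Qed.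
Lemma norm_starM x : `|star x * x| = `|x| ^+ 2. Proof. exact: cnorm_starM. Qed.

End CStarAlgebraIsAlgebra.

Section States.
Context {R : realType} {A : cstarAlgType R}.

Definition unitary (u : A) : Prop := star u * u = 1 /\ u * star u = 1.

(* On R[i], 0 <= z says that z is real and nonnegative. *)
Definition positive_functional (f : A -> R[i]) : Prop :=
  forall x : A, 0 <= f (star x * x).

(* Meaningful for bounded f only: sup of an unbounded set is 0. *)
Definition opnorm (f : A -> R[i]) : R :=
  sup [set rnorm (f x) | x in [set x : A | rnorm x <= 1]].

Definition state_space : set {scalar A} :=
  [set f : {scalar A} | [/\ continuous f, positive_functional f,
                            opnorm f = 1 & f 1 = 1]].

End States.
Arguments state_space {R} A.

Definition DW (R : realType) (A : cstarAlgType R) (a : A) : set (R[i] * R) :=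
  [set p | exists2 f : {scalar A}, state_space A f &
     f a = p.1 /\ f (star a * a) = (p.2)%:C%C].

(* Rcomplex R is R[i] as a vector space over R; the hull is the intersection
   of all convex subsets of the real vector space C x R which contain X. *)
Definition convex_hull (R : realType) (X : set (R[i] * R)) : set (R[i] * R) :=
  smallest (@convex_set R (Rcomplex R * R^o)%type) X.

(* The direct sum of a nonempty finite family of C*-algebras, with
   componentwise operations and the maximum norm. *)
Definition direct_sum (R : realType) (n : nat)
    (B : 'I_n.+1 -> cstarAlgType R) : Type :=
  {dffun forall i, B i}.

Section RNorm.
Context {R : realType} {V : normedZmodType R[i]}.
Implicit Types x y : V.

Lemma rnormE x : (rnorm x)%:C%C = `|x|.
Proof.
have := normr_ge0 x; rewrite /rnorm; case: `|x| => u v.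
by rewrite lecE => /andP[/eqP /= -> _].
Qed.

Lemma rnorm_ge0 x : 0 <= rnorm x.
Proof. by rewrite -lecR rnormE normr_ge0. Qed.

Lemma ler_rnormD x y : rnorm (x + y) <= rnorm x + rnorm y.
Proof. by rewrite -lecR rmorphD /= !rnormE ler_normD. Qed.

Lemma rnorm0_eq0 x : rnorm x = 0 -> x = 0.
Proof. by move=> x0; apply: normr0_eq0; rewrite -rnormE x0. Qed.

End RNorm.

Section DirectSum.
Context {R : realType} {n : nat} (B : 'I_n.+1 -> cstarAlgType R).
Local Notation S := (direct_sum B).

HB.instance Definition _ := Choice.copy S {dffun forall i, B i}.

Definition dsum (a : forall i, B i) : S := [ffun i => a i].
Definition dcomp (x : S) (i : 'I_n.+1) : B i :=
  (x : {dffun forall i, B i}) i.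

Lemma dsumE a i : dcomp (dsum a) i = a i.
Proof. by rewrite /dcomp /dsum ffunE. Qed.

Lemma direct_sumP (x y : S) : (forall i, dcomp x i = dcomp y i) -> x = y.
Proof. by move=> xy; apply/ffunP. Qed.

Definition ds_zero : S := dsum (fun i => 0).
Definition ds_opp (x : S) : S := dsum (fun i => - dcomp x i).
Definition ds_add (x y : S) : S := dsum (fun i => dcomp x i + dcomp y i).

Fact ds_addA : associative ds_add.
Proof. by move=> x y z; apply/direct_sumP => i; rewrite !dsumE addrA. Qed.
Fact ds_addC : commutative ds_add.
Proof. by move=> x y; apply/direct_sumP => i; rewrite !dsumE addrC. Qed.
Fact ds_add0 : left_id ds_zero ds_add.
Proof. by move=> x; apply/direct_sumP => i; rewrite !dsumE add0r. Qed.
Fact ds_addN : left_inverse ds_zero ds_opp ds_add.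
Proof. by move=> x; apply/direct_sumP => i; rewrite !dsumE addNr. Qed.

HB.instance Definition _ :=
  GRing.isZmodule.Build S ds_addA ds_addC ds_add0 ds_addN.

Definition ds_scale (c : R[i]) (x : S) : S := dsum (fun i => c *: dcomp x i).

Fact ds_scaleA c d x : ds_scale c (ds_scale d x) = ds_scale (c * d) x.
Proof. by apply/direct_sumP => i; rewrite !dsumE scalerA. Qed.
Fact ds_scale1 : left_id 1 ds_scale.
Proof. by move=> x; apply/direct_sumP => i; rewrite !dsumE scale1r. Qed.
Fact ds_scaleDr : right_distributive ds_scale +%R.
Proof. by move=> c x y; apply/direct_sumP => i; rewrite !dsumE scalerDr. Qed.
Fact ds_scaleDl x : {morph ds_scale^~ x : c d / c + d}.
Proof. by move=> c d; apply/direct_sumP => i; rewrite !dsumE scalerDl. Qed.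

HB.instance Definition _ := GRing.Zmodule_isLmodule.Build R[i] S
  ds_scaleA ds_scale1 ds_scaleDr ds_scaleDl.

Lemma dcomp0 i : dcomp (0 : S) i = 0. Proof. exact: dsumE. Qed.
Lemma dcompD (x y : S) i : dcomp (x + y) i = dcomp x i + dcomp y i.
Proof. exact: dsumE. Qed.
Lemma dcompN (x : S) i : dcomp (- x) i = - dcomp x i.
Proof. exact: dsumE. Qed.
Lemma dcompB (x y : S) i : dcomp (x - y) i = dcomp x i - dcomp y i.
Proof. by rewrite dcompD dcompN. Qed.
Lemma dcompZ (c : R[i]) (x : S) i : dcomp (c *: x) i = c *: dcomp x i.
Proof. exact: dsumE. Qed.

(* The maximum is taken in R, since R[i] is only partially ordered. *)
Definition ds_rnorm (x : S) : R := \big[Num.max/0]_i rnorm (dcomp x i).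
Definition ds_norm (x : S) : R[i] := (ds_rnorm x)%:C%C.

Lemma le_ds_rnorm (x : S) i : rnorm (dcomp x i) <= ds_rnorm x.
Proof. exact: (le_bigmax _ (fun i => rnorm (dcomp x i))). Qed.

Lemma ds_rnorm_le (x : S) (r : R) :
  (forall i, rnorm (dcomp x i) <= r) -> ds_rnorm x <= r.
Proof.
move=> xr; apply: bigmax_le => [|i _]; last exact: xr.
exact: le_trans (rnorm_ge0 _) (xr ord0).
Qed.

Lemma ds_rnorm_attained (x : S) : exists i, ds_rnorm x = rnorm (dcomp x i).
Proof.
have [||i _ xi] := @eq_bigmax _ R 'I_n.+1 0 ord0 xpredT
  (fun i => rnorm (dcomp x i)) => //; first by move=> i _; exact: rnorm_ge0.
by exists i.
Qed.

Lemma ds_rnorm_ge0 (x : S) : 0 <= ds_rnorm x.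
Proof. exact: le_trans (rnorm_ge0 _) (le_ds_rnorm x ord0). Qed.

Fact ds_normD (x y : S) : ds_norm (x + y) <= ds_norm x + ds_norm y.
Proof.
rewrite -rmorphD lecR; apply: ds_rnorm_le => i; rewrite dcompD.
by apply: le_trans (ler_rnormD _ _) _; rewrite lerD// le_ds_rnorm.
Qed.

Fact ds_normZ (c : R[i]) (x : S) : ds_norm (c *: x) = `|c| * ds_norm x.
Proof.
have rZ i : rnorm (dcomp (c *: x) i) = rnorm c * rnorm (dcomp x i).
  by apply: complexI; rewrite rmorphM /= !rnormE dcompZ normrZ.
rewrite -(rnormE c) -rmorphM; congr (_%:C)%C; apply: le_anti; apply/andP; split.
  by apply: ds_rnorm_le => i; rewrite rZ ler_wpM2l ?rnorm_ge0 ?le_ds_rnorm.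
by have [i ->] := ds_rnorm_attained x; rewrite -rZ le_ds_rnorm.
Qed.

Fact ds_norm0_eq0 (x : S) : ds_norm x = 0 -> x = 0.
Proof.
move=> /complexI x0; apply/direct_sumP => i; rewrite dcomp0.
by apply/rnorm0_eq0/le_anti; rewrite rnorm_ge0 andbT -x0 le_ds_rnorm.
Qed.

HB.instance Definition _ :=
  Lmodule_isNormed.Build R[i] S ds_normD ds_normZ ds_norm0_eq0.

Lemma ds_normE (x : S) : `|x| = (\big[Num.max/0]_i rnorm (dcomp x i))%:C%C.
Proof. by []. Qed.

Lemma le_norm_dcomp (x : S) i : `|dcomp x i| <= `|x|.
Proof. by rewrite -rnormE ds_normE lecR le_ds_rnorm. Qed.

Fact ds_complete (F : set_system S) : ProperFilter F -> cauchy F -> cvg F.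
Proof.
move=> FF /cauchyP cF.
have cvgi i : cvg ((dcomp^~ i) @ F).
  apply: cauchy_cvg; apply/cauchyP => e /cF[x Fx].
  exists (dcomp x i); rewrite /nbhs /=; apply: filterS Fx => y /=.
  rewrite -!ball_normE /= -dcompB; exact: le_lt_trans (le_norm_dcomp _ _).
pose l : S := dsum (fun i => lim ((dcomp^~ i) @ F)).
apply/cvg_ex; exists l; apply/cvgrPdist_le => e e0.
have : \forall x \near F, forall i, `|dcomp l i - dcomp x i| <= e.
  apply: filter_forall => i; rewrite dsumE.
  by move: e e0; apply/cvgrPdist_le; exact: cvgi.
apply: filterS => x lx; have [i ix] := ds_rnorm_attained (l - x).
rewrite ds_normE -/(ds_rnorm _) ix rnormE dcompB; exact: lx.
Qed.

HB.instance Definition _ := Uniform_isComplete.Build S ds_complete.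

Definition ds_one : S := dsum (fun i => 1).
Definition ds_mul (x y : S) : S := dsum (fun i => dcomp x i * dcomp y i).
Definition ds_star (x : S) : S := dsum (fun i => star (dcomp x i)).

Fact ds_mulA : associative ds_mul.
Proof. by move=> x y z; apply/direct_sumP => i; rewrite !dsumE mulrA. Qed.
Fact ds_mul1l : left_id ds_one ds_mul.
Proof. by move=> x; apply/direct_sumP => i; rewrite !dsumE mul1r. Qed.
Fact ds_mul1r : right_id ds_one ds_mul.
Proof. by move=> x; apply/direct_sumP => i; rewrite !dsumE mulr1. Qed.
Fact ds_mulDl : left_distributive ds_mul +%R.
Proof.
by move=> x y z; apply/direct_sumP => i; rewrite !(dsumE, dcompD) mulrDl.
Qed.
Fact ds_mulDr : right_distributive ds_mul +%R.
Proof.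
by move=> x y z; apply/direct_sumP => i; rewrite !(dsumE, dcompD) mulrDr.
Qed.
Fact ds_one_neq0 : ds_one != 0.
Proof.
apply/eqP => /(congr1 (fun x => dcomp x ord0)); rewrite dsumE dcomp0 => /eqP.
by rewrite oner_eq0.
Qed.
Fact ds_scaleAl (c : R[i]) (x y : S) : c *: ds_mul x y = ds_mul (c *: x) y.
Proof.
by apply/direct_sumP => i; rewrite !(dsumE, dcompZ) scalerAl.
Qed.
Fact ds_scaleAr (c : R[i]) (x y : S) : c *: ds_mul x y = ds_mul x (c *: y).
Proof.
by apply/direct_sumP => i; rewrite !(dsumE, dcompZ) scalerAr.
Qed.
Fact ds_normM_le (x y : S) : `|ds_mul x y| <= `|x| * `|y|.
Proof.
have [i ixy] := ds_rnorm_attained (ds_mul x y).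
rewrite [leLHS]ds_normE -/(ds_rnorm _) ixy rnormE dsumE.
by apply: le_trans (normM_le _ _) _; rewrite ler_pM ?le_norm_dcomp.
Qed.
Fact ds_starK : involutive ds_star.
Proof. by move=> x; apply/direct_sumP => i; rewrite !dsumE starK. Qed.
Fact ds_starD : {morph ds_star : x y / x + y}.
Proof.
by move=> x y; apply/direct_sumP => i; rewrite !(dsumE, dcompD) starD.
Qed.
Fact ds_starZ (c : R[i]) (x : S) : ds_star (c *: x) = c^* *: ds_star x.
Proof.
by apply/direct_sumP => i; rewrite !(dsumE, dcompZ) starZ.
Qed.
Fact ds_starM (x y : S) : ds_star (ds_mul x y) = ds_mul (ds_star y) (ds_star x).
Proof. by apply/direct_sumP => i; rewrite !dsumE starM. Qed.
Fact ds_norm_starM (x : S) : `|ds_mul (ds_star x) x| = `|x| ^+ 2.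
Proof.
have E i : `|dcomp (ds_mul (ds_star x) x) i| = `|dcomp x i| ^+ 2.
  by rewrite !dsumE norm_starM.
apply: le_anti; apply/andP; split.
  have [i ix] := ds_rnorm_attained (ds_mul (ds_star x) x).
  rewrite [leLHS]ds_normE -/(ds_rnorm _) ix rnormE E.
  by rewrite lerXn2r ?nnegrE ?le_norm_dcomp.
have [i ix] := ds_rnorm_attained x.
rewrite [X in X ^+ 2]ds_normE -/(ds_rnorm _) ix rnormE -E.
exact: le_norm_dcomp.
Qed.

HB.instance Definition _ := isCStarAlgebra.Build R S
  ds_mulA ds_mul1l ds_mul1r ds_mulDl ds_mulDr ds_one_neq0 ds_scaleAl ds_scaleAr
  ds_normM_le ds_starK ds_starD ds_starZ ds_starM ds_norm_starM.

End DirectSum.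

(* Main.v *)
(* A state satisfies |f x| <= |x|, f x^* = conj (f x) and |f x|^2 <= f (x^* x),
   which gives (i); (ii) follows by composing states with conjugation by u, and
   (iii) by expanding (alpha a + beta)^* (alpha a + beta) under the same state.
   For (iv), DW is convex because states are, and composing a state of a summand
   with the projection gives a state of the sum. Conversely, a state f of the
   sum splits as f = sum_i f_i over the summands, where |f_i x| <= f_i(1) |x|,
   so each f_i with f_i(1) <> 0 is a positive multiple of a state, the other f_i
   vanish, and the weights f_i(1) add up to f(1) = 1. *)

Require Import Defs.
From HB Require Import structures.
From mathcomp Require Import all_boot all_order all_algebra.
From mathcomp Require Import all_classical all_reals all_analysis.
From mathcomp Require Import complex.
Set Implicit Arguments.
Unset Strict Implicit.
Unset Printing Implicit Defensive.
Import Order.TTheory GRing.Theory Num.Theory.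
Import numFieldNormedType.Exports.
Local Open Scope classical_set_scope.
Local Open Scope ring_scope.

(* derive.v also exports a [dcomp]. *)
Local Notation dcomp := Defs.dcomp.

(** * The unit, and states as contractive positive functionals *)

Lemma star1 (R : realType) (A : cstarAlgType R) : star (1 : A) = 1.
Proof.
by rewrite -[RHS](starK (1 : A)) -[star 1 in RHS]mul1r starM starK mul1r.
Qed.

Lemma norm_one (R : realType) (A : cstarAlgType R) : `|1 : A| = 1.
Proof.
have n0 : `|1 : A| != 0 by rewrite normr_eq0 oner_eq0.
by apply: (mulfI n0); rewrite mulr1 -expr2 -norm_starM star1 mulr1.
Qed.

Lemma conjcE (R : realType) (z : R[i]) : z^* = conjc z.
Proof. by []. Qed.

(** Stated for bare functions, with a pointwise bound in place of continuity and the supremum, so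
    that new states can be checked before being packed as linear maps. *)
Definition is_state (R : realType) (A : cstarAlgType R) (F : A -> R[i]) :=
  [/\ scalar F, positive_functional F, forall x, `|F x| <= `|x| & F 1 = 1].

Lemma state_spaceP (R : realType) (A : cstarAlgType R) (f : {scalar A}) :
  state_space A f <-> is_state f.
Proof.
split=> [[fc fp fn f1]|[flin fp fle f1]].
  split=> //; first exact: linearP.
  (* Continuity bounds [f] on the unit ball, so the supremum in [opnorm] is a genuine one; scaling
     by the inverse norm then leaves the ball. *)
  have /bounded_funP/(_ 1)[M fM] : bounded_near f (nbhs (0 : A)).
    by apply/linear_bounded_continuous.
  have fub x : rnorm x <= 1 -> rnorm (f x) <= 1.
    move=> x1; rewrite -fn; apply: ub_le_sup; last by exists x.
    exists (complex.Re M) => _ [y y1 <-].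
    have /fM : `|y| <= 1 by rewrite -rnormE lecR.
    by rewrite lecE => /andP[].
  move=> x; have [->|x0] := eqVneq x 0; first by rewrite linear0 !normr0.
  have nx : 0 < `|x| by rewrite normr_gt0.
  have /fub : rnorm (`|x|^-1 *: x) <= 1.
    by rewrite -lecR rnormE normrZ normfV normr_id mulVf// gt_eqF.
  rewrite -lecR rnormE linearZ /= normrM normfV normr_id.
  by rewrite ler_pdivrMl// mulr1.
split=> //.
  apply/linear_bounded_continuous/bounded_funP => r; exists r => x.
  exact: le_trans.
have fb x : rnorm x <= 1 -> rnorm (f x) <= 1.
  by rewrite -!lecR !rnormE; exact: le_trans.
(* The supremum 1 is attained at the unit. *)
have one1 : [set rnorm (f x) | x in [set x : A | rnorm x <= 1]] 1.
  exists 1; first by rewrite /= -lecR rnormE norm_one.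
  by apply: complexI; rewrite rnormE f1 normr1.
apply: le_anti; apply/andP; split.
  by apply: ge_sup; [exists 1|move=> _ [x x1 <-]; exact: fb].
by apply: ub_le_sup => //; exists 1 => _ [x x1 <-]; exact: fb.
Qed.

Lemma DWP (R : realType) (A : cstarAlgType R) (a : A) (p : R[i] * R) :
  DW a p <-> exists2 f : {scalar A}, is_state f &
    f a = p.1 /\ f (star a * a) = (p.2)%:C%C.
Proof. by split=> [] [f /state_spaceP fS fa]; exists f. Qed.

Lemma state_DW (R : realType) (A : cstarAlgType R) (F : A -> R[i]) (a : A)
    (p : R[i] * R) :
  is_state F -> F a = p.1 -> F (star a * a) = (p.2)%:C%C -> DW a p.
Proof.
move=> FS Fa Faa; have [Flin _ _ _] := FS.
pose f : {scalar A} := HB.pack F (GRing.isLinear.Build _ _ _ _ F Flin).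
by apply/DWP; exists f.
Qed.

(** * Hermitian symmetry and the Cauchy-Schwarz inequality *)

Lemma star_affineM (R : realType) (A : cstarAlgType R) (a : A)
    (alpha beta : R[i]) :
  star (alpha *: a + beta *: 1) * (alpha *: a + beta *: 1) =
  (alpha^* * alpha) *: (star a * a) + (alpha^* * beta) *: star a
  + (alpha * beta^*) *: a + (beta^* * beta) *: 1.
Proof.
rewrite starD !starZ star1 mulrDl !mulrDr -!scalerAl -!scalerAr !scalerA.
by rewrite !mulr1 mul1r [beta^* * alpha]mulrC !addrA.
Qed.

Lemma positive_functional_star (R : realType) (A : cstarAlgType R)
    (f : {scalar A}) (x : A) :
  positive_functional f -> f (star x) = (f x)^*.
Proof.
move=> fp.
have fIm (beta : R[i]) :
    complex.Im (beta * f (star x)) + complex.Im (beta^* * f x) = 0.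
  have := ger0_Im (fp (1 *: x + beta *: 1)).
  rewrite star_affineM !linearD !linearZ /= conjC1 !mul1r.
  (* In this form [f 1] is seen to be nonnegative. *)
  have -> : f 1 = f (star 1 * 1) by rewrite star1 mulr1.
  have -> : complex.Im (beta^* * beta * f (star 1 * 1)) = 0.
    by apply: ger0_Im; rewrite mulr_ge0// mulrC mul_conjC_ge0.
  by rewrite (ger0_Im (fp x)) add0r addr0.
have := fIm 'i%C; have := fIm 1; rewrite conjC1 !mul1r !conjcE.
case: (f (star x)) (f x) => [p q] [r s]; simpc => /= /eqP.
by rewrite addr_eq0 => /eqP -> /eqP; rewrite subr_eq0 => /eqP ->.
Qed.

(** Positivity at x - f(x) 1: the value there is the variance f(x^* x) - |f x|^2. *)
Lemma state_cauchy (R : realType) (A : cstarAlgType R)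
    (f : {scalar A}) (x : A) :
  is_state f -> `|f x| ^+ 2 <= f (star x * x).
Proof.
move=> [_ fp _ f1]; have := fp (1 *: x + (- f x) *: 1).
rewrite star_affineM !linearD !linearZ /= positive_functional_star// f1.
rewrite conjC1 !mul1r mulr1 rmorphN mulrNN !mulNr subrK.
by rewrite subr_ge0 normCK.
Qed.

(** * Unitary conjugation *)

Lemma norm_star (R : realType) (A : cstarAlgType R) (x : A) : `|star x| = `|x|.
Proof.
(* The C*-identity and submultiplicativity give |y|^2 <= |y^*| |y|. *)
have le y : `|y : A| <= `|star y|.
  have [->|y0] := eqVneq y 0; first by rewrite normr0.
  have ny : 0 < `|y| by rewrite normr_gt0.
  by rewrite -(ler_pM2r ny) -expr2 -norm_starM normM_le.
by apply: le_anti; rewrite le andbT -{2}[x]starK le.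
Qed.

Lemma unitary_norm (R : realType) (A : cstarAlgType R) (u : A) :
  unitary u -> `|u| = 1.
Proof.
move=> [uu _]; apply/eqP; rewrite -(@pexpr_eq1 _ _ 2)//.
by rewrite -norm_starM uu norm_one.
Qed.

(** Positivity survives because u^* x^* x u = (x u)^* (x u), and the bound because u and u^* have
    norm 1. *)
Lemma state_unitary (R : realType) (A : cstarAlgType R) (f : {scalar A})
    (u : A) :
  is_state f -> unitary u -> is_state (fun x => f (star u * x * u)).
Proof.
move=> [flin fp fle f1] uU; have [uu _] := uU; split.
- move=> c x y; rewrite mulrDr mulrDl -scalerAr -scalerAl.
  by rewrite linearD linearZ.
- by move=> x; have := fp (x * u); rewrite starM !mulrA.
- move=> x; apply: le_trans (fle _) _; apply: le_trans (normM_le _ _) _.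
  rewrite (unitary_norm uU) mulr1; apply: le_trans (normM_le _ _) _.
  by rewrite norm_star (unitary_norm uU) mul1r.
- by rewrite mulr1 uu.
Qed.

Lemma DW_unitary_sub (R : realType) (A : cstarAlgType R) (a u : A) :
  unitary u -> DW (star u * a * u) `<=` DW a.
Proof.
move=> uU p /DWP[f fS [fa faa]]; have [_ uu'] := uU.
apply: (state_DW (state_unitary fS uU)) => //.
rewrite -faa !starM starK; congr (f _).
have uuK y : u * (star u * y) = y by rewrite mulrA uu' mul1r.
by rewrite -!mulrA uuK.
Qed.

Lemma DW_unitary (R : realType) (A : cstarAlgType R) (a u : A) :
  unitary u -> DW a = DW (star u * a * u).
Proof.
move=> uU; have [uu uu'] := uU.
apply/seteqP; split; last exact: DW_unitary_sub.
(* The other inclusion is the same one for the unitary [star u], which undoes the conjugation. *)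
rewrite [X in DW X `<=` _](_ : _ = star (star u) * (star u * a * u) * star u).
  by apply: DW_unitary_sub; split; rewrite starK.
by rewrite starK !mulrA uu' mul1r -mulrA uu' mulr1.
Qed.

(** * Affine images of an element *)

Lemma state_affineM (R : realType) (A : cstarAlgType R) (a : A)
    (alpha beta : R[i]) (f : {scalar A}) :
  is_state f ->
  f (star (alpha *: a + beta *: 1) * (alpha *: a + beta *: 1)) =
  (rnorm alpha ^+ 2 * complex.Re (f (star a * a))
   + 2 * complex.Re (alpha * beta^* * f a) + rnorm beta ^+ 2)%:C%C.
Proof.
move=> [_ fp _ f1].
rewrite star_affineM !linearD !linearZ /= positive_functional_star// f1 mulr1.
rewrite ![_^* * _]mulrC -!normCK; set z := alpha * _ * f a.
(* The two cross terms are conjugate, so they add up to twice a real part. *)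
have -> : beta * alpha^* * (f a)^* = conjc z.
  by rewrite -conjcE /z !rmorphM /= conjCK [beta * _]mulrC.
rewrite -[_ + conjc z + z]addrA [conjc z + z]addrC addcJ.
rewrite -{1}[f (star a * a)]RRe_real ?ger0_real// -!rnormE.
by rewrite -!rmorphXn -[2%:R](rmorph_nat (real_complex R)) -!rmorphM -!rmorphD.
Qed.

(** Each inclusion keeps the state and changes only the element, so alpha = 0 is covered too. *)
Lemma DW_affine (R : realType) (A : cstarAlgType R) (a : A)
    (alpha beta : R[i]) :
  DW (alpha *: a + beta *: 1) =
  [set (alpha * p.1 + beta,
        rnorm alpha ^+ 2 * p.2
        + 2 * complex.Re (alpha * beta^* * p.1)
        + rnorm beta ^+ 2) | p in DW a].
Proof.
have fE (f : {scalar A}) : is_state f ->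
    f (alpha *: a + beta *: 1) = alpha * f a + beta.
  by move=> [_ _ _ f1]; rewrite linearD !linearZ /= f1 mulr1.
apply/seteqP; split=> [p /DWP[f fS [fa faa]]|_ [p /DWP[f fS [fa faa]] <-]].
  exists (f a, complex.Re (f (star a * a))).
    apply/DWP; exists f => //; split=> //=.
    by have [_ fp _ _] := fS; rewrite RRe_real// ger0_real.
  rewrite /= -fE// fa.
  move: faa; rewrite state_affineM// => /complexI ->.
  by case: p {fa}.
apply/DWP; exists f => //=; rewrite fE// -fa state_affineM//; split=> //.
by rewrite faa.
Qed.

Lemma DW_ge (R : realType) (A : cstarAlgType R) (a : A) (mu : R[i]) (r : R) :
  DW a (mu, r) -> rnorm mu ^+ 2 <= r.
Proof.
move=> /DWP[f fS [/= <- fr]]; rewrite -lecR -fr rmorphXn /= rnormE.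
exact: state_cauchy.
Qed.

(** * Convexity of the shell *)

Lemma state_convex (R : realType) (A : cstarAlgType R) (f g : {scalar A})
    (t : R) :
  0 <= t <= 1 -> is_state f -> is_state g ->
  is_state (fun x => t%:C%C * f x + (1 - t)%:C%C * g x).
Proof.
move=> /andP[t0 t1] [_ fp fle f1] [_ gp gle g1].
have t0c : 0 <= t%:C%C by rewrite ler0c.
have s0c : 0 <= (1 - t)%:C%C by rewrite ler0c subr_ge0.
have ts : t%:C%C + (1 - t)%:C%C = 1 by rewrite -rmorphD addrC subrK.
split.
- move=> c x y; rewrite !linearD !linearZ /= !mulrDr !(mulrCA _ c).
  by rewrite addrACA.
- by move=> x; rewrite addr_ge0// mulr_ge0.
- move=> x; rewrite -[leRHS]mul1r -ts mulrDl.
  rewrite (le_trans (ler_normD _ _))// !normrM (ger0_norm t0c) (ger0_norm s0c).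
  by rewrite lerD// ler_wpM2l.
- by rewrite f1 g1 !mulr1.
Qed.

Lemma convex_DW (R : realType) (A : cstarAlgType R) (a : A) :
  @convex_set R (Rcomplex R * R^o)%type (DW a).
Proof.
move=> [x r] [y s] l /set_mem /DWP[f fS [/= fa faa]].
move=> /set_mem /DWP[g gS [/= ga gaa]].
have l01 : 0 <= l%:num <= 1 by rewrite ge0 le1.
apply/mem_set/(state_DW (state_convex l01 fS gS)) => /=.
  (* In coordinates, the real scaling of [Rcomplex R] agrees with multiplication by a real in
     [R[i]]. *)
  rewrite fa ga; case: x y {fa ga} => [x1 x2] [y1 y2].
  by simpc.
by rewrite faa gaa -!rmorphM -rmorphD.
Qed.

(** * Projections and injections of the summands *)

Lemma state_dcomp (R : realType) (n : nat) (B : 'I_n.+1 -> cstarAlgType R)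
    (i : 'I_n.+1) (f : {scalar B i}) :
  is_state f -> is_state (fun x : direct_sum B => f (dcomp x i)).
Proof.
move=> [_ fp fle f1]; split.
- by move=> c x y; rewrite dcompD dcompZ linearD linearZ.
- by move=> x; rewrite dsumE dsumE.
- by move=> x; apply: le_trans (fle _) (le_norm_dcomp _ _).
- by rewrite dsumE.
Qed.

Lemma sub_DW_dsum (R : realType) (n : nat) (B : 'I_n.+1 -> cstarAlgType R)
    (a : forall i, B i) (i : 'I_n.+1) :
  DW (a i) `<=` DW (dsum a).
Proof.
move=> p /DWP[f fS [fa faa]]; apply: (state_DW (state_dcomp fS)).
  by rewrite dsumE.
by rewrite !dsumE.
Qed.

(** The embedding of the i-th summand, not unital in general: [dinj 1] is the projection onto that
    summand. *)
Definition dinj (R : realType) (n : nat) (B : 'I_n.+1 -> cstarAlgType R)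
    (i : 'I_n.+1) (x : B i) : direct_sum B :=
  dsum (@eqtype.dfwith _ (fun j => B j) (fun=> 0) i x).

Section DirectSumInjections.
Context {R : realType} {n : nat} (B : 'I_n.+1 -> cstarAlgType R).
Implicit Types i j : 'I_n.+1.

Lemma dcomp1 i : dcomp (1 : (direct_sum B : cstarAlgType R)) i = 1.
Proof. exact: dsumE. Qed.

Lemma dcomp_dinj i (x : B i) : dcomp (dinj x) i = x.
Proof. by rewrite dsumE dfwith_in. Qed.

Lemma dcomp_dinj_neq i j (x : B i) : i != j -> dcomp (dinj x) j = 0.
Proof. by move=> ij; rewrite dsumE dfwith_out. Qed.

Lemma dinj_linear i (c : R[i]) (x y : B i) :
  dinj (c *: x + y) = c *: dinj x + dinj y.
Proof.
apply/direct_sumP => j; rewrite dcompD dcompZ.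
have [<-|ij] := eqVneq i j; first by rewrite !dcomp_dinj.
by rewrite !dcomp_dinj_neq// scaler0 addr0.
Qed.

Lemma dinj_starM i (x : B i) : star (dinj x) * dinj x = dinj (star x * x).
Proof.
apply/direct_sumP => j; rewrite !dsumE.
have [<-|ij] := eqVneq i j; first by rewrite !dfwith_in.
by rewrite !dfwith_out// mulr0.
Qed.

Lemma dinj_sum (x : direct_sum B) : \sum_i dinj (dcomp x i) = x.
Proof.
apply/direct_sumP => j.
rewrite (big_morph (fun y => dcomp y j) (fun y z => dcompD y z j) (dcomp0 B j)).
rewrite (bigD1 j)//= dcomp_dinj big1 ?addr0// => i ij.
by rewrite dcomp_dinj_neq.
Qed.

Lemma dinj1_ge0 (f : {scalar (direct_sum B)}) i :
  positive_functional f -> 0 <= f (dinj (1 : B i)).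
Proof. by move=> fp; rewrite -[1]mulr1 -[X in X * 1]star1 -dinj_starM. Qed.

(* With c the phase making c f(x) = |f(x)|, the element y equal to c x in
   component i and to |x| elsewhere has norm at most |x|, so that
   |f(x)| + |x| (1 - f_i(1)) = f y <= |x|; no square root of a positive element
   is needed. *)
Lemma state_dinj_le (f : {scalar (direct_sum B)}) i (x : B i) :
  is_state f -> `|f (dinj x)| <= f (dinj (1 : B i)) * `|x|.
Proof.
move=> [_ fp fle f1].
have [c c1 cf] : exists2 c : R[i], `|c| = 1 & c * f (dinj x) = `|f (dinj x)|.
  have [->|fx0] := eqVneq (f (dinj x)) 0.
    by exists 1; rewrite ?normr1// mulr0 normr0.
  have nf : `|f (dinj x)| != 0 by rewrite normr_eq0.
  exists ((f (dinj x))^* / `|f (dinj x)|).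
    by rewrite normrM norm_conjC normfV normr_id divff.
  by rewrite mulrAC [_^* * _]mulrC -normCK expr2 mulfK.
pose y : direct_sum B := c *: dinj x
  + `|x| *: ((1 : (direct_sum B : cstarAlgType R)) - dinj (1 : B i)).
have ny : `|y| <= `|x|.
  have [j yj] := ds_rnorm_attained y.
  rewrite ds_normE -/(ds_rnorm y) yj rnormE dcompD !dcompZ dcompB dcomp1.
  have [<-|ij] := eqVneq i j.
    by rewrite !dcomp_dinj subrr scaler0 addr0 normrZ c1 mul1r.
  rewrite !dcomp_dinj_neq// scaler0 add0r subr0 normrZ normr_id.
  by rewrite norm_one mulr1.
have t0 : 0 <= f (dinj (1 : B i)) by exact: dinj1_ge0.
have fyE : f y = `|f (dinj x)| + `|x| * (1 - f (dinj (1 : B i))).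
  by rewrite linearD !linearZ /= cf linearB f1.
have : f y <= `|x|.
  (* [f y] is real, hence at most its modulus. *)
  apply: le_trans (le_trans (fle y) ny); rewrite real_ler_norm// fyE.
  by rewrite realD// realM// realB ?real1// ger0_real.
by rewrite fyE mulrBr mulr1 addrCA gerDl subr_le0 mulrC.
Qed.

End DirectSumInjections.

(** * Finite convex combinations *)

Lemma scalecE (R : realType) (r : R) (z : Rcomplex R) :
  r *: z = r%:C%C * z :> R[i].
Proof. by case: z => x y; simpc. Qed.

(** Induction on the list: the tail is replaced by its barycentre. Positive weights and a nonempty
    list make every normalization meaningful. *)
Lemma convex_set_sum (R : realType) (E : lmodType R) (C : set E)
    (I : eqType) (w : I -> R) (p : I -> E) (i0 : I) (s : seq I) :
  @convex_set R E C ->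
  (forall i, i \in i0 :: s -> 0 < w i /\ C (p i)) ->
  C ((\sum_(i <- i0 :: s) w i)^-1 *: \sum_(i <- i0 :: s) w i *: p i).
Proof.
move=> cC; elim: s i0 => [|i1 s IH] i0 H.
  have [w0 Cp] := H i0 (mem_head _ _).
  by rewrite !big_seq1 scalerA mulVf ?scale1r// gt_eqF.
have [w0 Cp] := H i0 (mem_head _ _).
have /IH Cs : forall i, i \in i1 :: s -> 0 < w i /\ C (p i).
  by move=> i si; apply: H; rewrite inE si orbT.
rewrite big_cons [X in _ *: X]big_cons; set W := \sum_(i <- _ :: _) w i in Cs *.
set P := \sum_(i <- _ :: _) w i *: p i in Cs *.
have W0 : 0 < W.
  rewrite /W big_cons ltr_pwDl//.
    by have [] := H i1 _; rewrite ?inE ?eqxx ?orbT.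
  rewrite big_seq sumr_ge0// => i si; apply/ltW.
  by have [] := H i _; rewrite ?inE ?si ?orbT.
have T0 : 0 < w i0 + W by rewrite addr_gt0.
(* The head gets its share of the total weight, the barycentre of the tail the rest. *)
have l0 : 0 <= w i0 / (w i0 + W) by rewrite divr_ge0 ?ltW.
have l1 : w i0 / (w i0 + W) <= 1 by rewrite ler_pdivrMr// mul1r lerDl ltW.
have := cC (p i0) (W^-1 *: P) (Itv01 l0 l1) (mem_set Cp) (mem_set Cs).
move=> /set_mem; congr (C _); rewrite /conv /=.
have -> : unstable.onem (w i0 / (w i0 + W)) = W / (w i0 + W).
  rewrite /unstable.onem -{1}(@divff _ (w i0 + W)) ?gt_eqF// -mulrBl.
  by rewrite addrAC subrr add0r.
rewrite scalerDr !scalerA [_^-1 * _]mulrC; congr (_ + _ *: _).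
by rewrite mulrAC mulfV ?mul1r// gt_eqF.
Qed.

(** * The shell of a direct sum *)

Section DirectSumDW.
Context {R : realType} {n : nat} (B : 'I_n.+1 -> cstarAlgType R).
Implicit Types i j : 'I_n.+1.

Lemma DW_dsum_sub (a : forall i, B i) :
  DW (dsum a) `<=` convex_hull (\bigcup_i DW (a i)).
Proof.
move=> p /DWP[f fS [fa faa]] C [/= cC aC]; have [_ fp fle f1] := fS.
have t0 i : 0 <= f (dinj (1 : B i)) by exact: dinj1_ge0.
have fE (x : direct_sum B) : f x = \sum_i f (dinj (dcomp x i)).
  by rewrite -{1}(dinj_sum x) raddf_sum.
pose w i : R := complex.Re (f (dinj (1 : B i))).
have wE i : (w i)%:C%C = f (dinj (1 : B i)) by rewrite RRe_real// ger0_real.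
have w0 i : 0 <= w i by rewrite -lecR wE.
have w1 : \sum_i w i = 1.
  apply: complexI; rewrite rmorph_sum rmorph1 -f1 fE.
  by apply: eq_bigr => i _; rewrite dcomp1; exact: wE.
(* The point given by the normalized restriction of [f] to summand i. If [w i] is 0, its inverse is
   0 by convention and [q i] is the origin, which may lie outside [C]. *)
pose q i : Rcomplex R * R^o :=
  ((w i)^-1%:C%C * f (dinj (a i)),
   (w i)^-1 * complex.Re (f (dinj (star (a i) * a i)))).
have fpi i (x : B i) : 0 <= f (dinj (star x * x)) by rewrite -dinj_starM.
have qC i : 0 < w i -> C (q i).
  move=> wi; apply: aC; exists i => //.
  apply: (@state_DW _ _ (fun x => (w i)^-1%:C%C * f (dinj x))) => //=;
    last by rewrite rmorphM /= RRe_real// ger0_real.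
  have wC : 0 < (w i)%:C%C by rewrite ltcR.
  have wiC : 0 <= (w i)^-1%:C%C by rewrite ler0c invr_ge0 ltW.
  split.
  - by move=> c x y; rewrite dinj_linear linearD linearZ mulrDr mulrCA.
  - by move=> x; rewrite mulr_ge0.
  - move=> x; rewrite normrM (ger0_norm wiC) fmorphV /=.
    by rewrite ler_pdivrMl// wE; exact: (state_dinj_le x fS).
  - by rewrite -wE fmorphV mulVf// gt_eqF.
have wq i : w i *: q i =
    (f (dinj (a i)), complex.Re (f (dinj (star (a i) * a i)))).
  have := w0 i; rewrite le_eqVlt => /predU1P[wi|wi].
    (* A summand of weight zero contributes nothing, by the bound |f_i x| <= f_i(1) |x|. *)
    have f0 (x : B i) : f (dinj x) = 0.
      apply/eqP; rewrite -normr_le0 (le_trans (state_dinj_le _ _))//.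
      by rewrite -wE -wi mul0r.
    by rewrite -wi scale0r !f0.
  rewrite /q; congr (_, _).
    by rewrite scalecE mulrA -rmorphM divff ?mul1r// gt_eqF.
  by rewrite [_ *: _]mulrA divff ?mul1r// gt_eqF.
have pE : \sum_i w i *: q i = p.
  rewrite (eq_bigr _ (fun i _ => wq i)).
  rewrite [LHS]surjective_pairing [RHS]surjective_pairing -fa.
  rewrite -[p.2]/(complex.Re (p.2)%:C%C) -faa !fE !raddf_sum /=.
  by congr (_, _); apply: eq_bigr => i _; rewrite !dsumE.
(* Only indices of positive weight are kept, since only their points are known to lie in [C]; both
   sums are unchanged. *)
pose s := [seq i <- enum 'I_n.+1 | 0 < w i].
have sE (V : nmodType) (F : 'I_n.+1 -> V) :
    (forall i, w i = 0 -> F i = 0) -> \sum_(i <- s) F i = \sum_i F i.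
  move=> F0; rewrite big_filter big_enum_cond /=; apply: big_rmcond => i.
  by rewrite lt_neqAle w0 andbT negbK => /eqP/esym/F0.
have sw : \sum_(i <- s) w i = 1 by rewrite sE.
have sq : \sum_(i <- s) w i *: q i = p.
  by rewrite sE// => i ->; rewrite scale0r.
have : forall i, i \in s -> 0 < w i /\ C (q i).
  by move=> i; rewrite mem_filter => /andP[wi _]; split=> //; exact: qC.
(* The list is not empty because its weights sum to 1. *)
case: s sw sq {sE} => [|i0 s] sw sq sC.
  by move/eqP: sw; rewrite big_nil eq_sym oner_eq0.
by have := convex_set_sum cC sC; rewrite sw sq invr1 scale1r.
Qed.

(** The reverse inclusion is minimality of the hull: the shell of the sum is convex and contains
    those of the summands. *)
Lemma DW_dsum (a : forall i, B i) :
  DW (dsum a) = convex_hull (\bigcup_i DW (a i)).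
Proof.
apply/seteqP; split; first exact: DW_dsum_sub.
apply: smallest_sub; first exact: convex_DW.
by move=> p [i _]; exact: sub_DW_dsum.
Qed.

End DirectSumDW.

Theorem theorem2p4 (R : realType) :
  (forall (A : cstarAlgType R) (a : A),
    [/\ (forall (mu : R[i]) (r : R), DW a (mu, r) -> r >= rnorm mu ^+ 2),
        (forall u : A, unitary u -> DW a = DW (star u * a * u)) &
        (forall alpha beta : R[i],
          DW (alpha *: a + beta *: 1) =
          [set (alpha * p.1 + beta,
                rnorm alpha ^+ 2 * p.2
                + 2 * complex.Re (alpha * beta^* * p.1)
                + rnorm beta ^+ 2) | p in DW a])]) /\
  (forall (n : nat) (B : 'I_n.+1 -> cstarAlgType R) (a : forall i, B i),
    DW (dsum a) = convex_hull (\bigcup_i DW (a i))).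
Proof.
split=> [A a|n B a]; last exact: DW_dsum.
split; [exact: DW_ge|exact: DW_unitary|exact: DW_affine].
Qed.
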